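(* Let $(x_i,f_i)_{i\in\mathbb{N}}\subset X\times X^*$ be an unconditional Schauder frame of a Banach space $X$ and assume that for all $m\in\mathbb{N}$ $$\lim_{n\to\infty}\big\|f_m|_{\mathrm{span}(x_i:i\ge n)}\big\|=0.$$ Then $X$ is reflexive if and only if $X$ contains neither an isomorphic copy of $c_0$ nor an isomorphic copy of $\ell_1$.
   Context: All Banach spaces are over $\mathbb{R}$. Let $X$ be a separable Banach space. A sequence $(x_i,f_i)_{i\in\mathbb{N}}$ with $x_i\in X$, $f_i\in X^*$ is a (Schauder) frame of $X$ if for every $x\in X$, $x=\sum_{i=1}^\infty f_i(x)x_i$ with norm convergence of the partial sums; it is unconditional if for every $x\in X$ this series converges unconditionally. Convention: $x_i\ne 0$ and $f_i\neq 0$ for all $i$. For $f\in X^*$ and a subspace $E\subset X$, $\|f|_E\|$ is the norm of the restriction of $f$ to $E$. *)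

(* Defs.v *)
From HB Require Import structures.
From mathcomp Require Import all_boot all_order all_algebra.
From mathcomp Require Import all_classical all_reals.
From mathcomp Require Import topology normedtype sequences.

Set Implicit Arguments.
Unset Strict Implicit.
Unset Printing Implicit Defensive.
Import Order.TTheory GRing.Theory Num.Theory.
Import numFieldNormedType.Exports.
Local Open Scope classical_set_scope.
Local Open Scope ring_scope.

Section sup_lemmas.
Context {R : realType}.
Implicit Types (A : set R) (k c : R).

Lemma sup_le_ge0 A c : 0 <= c -> ubound A c -> sup A <= c.
Proof.
move=> c0 Ac; have [->|/set0P A0] := eqVneq A set0; first by rewrite sup0.
exact: ge_sup.
Qed.

Lemma sup_image_scale (T : Type) (D : set T) (g : T -> R) k :
    0 <= k -> D !=set0 -> has_ubound (g @` D) ->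
  sup [set k * g t | t in D] = k * sup (g @` D).
Proof.
move=> k0 [t0 Dt0] ubg; apply/eqP; rewrite eq_le; apply/andP; split.
  apply: ge_sup; first by exists (k * g t0), t0.
  by move=> _ [t Dt <-]; rewrite ler_wpM2l// ub_le_sup//; exists t.
have [->|kn0] := eqVneq k 0.
  rewrite mul0r (_ : [set _ | _ in _] = [set 0]) ?sup1//.
  apply/seteqP; split=> [_ [t _ <-]|_ ->] /=; first by rewrite mul0r.
  by exists t0; rewrite ?mul0r.
have kp : 0 < k by rewrite lt_def kn0.
rewrite mulrC -ler_pdivlMr//; apply: ge_sup; first by exists (g t0), t0.
move=> _ [t Dt <-]; rewrite ler_pdivlMr// mulrC ub_le_sup//; last by exists t.
case: ubg => M ubM; exists (k * M) => _ [s Ds <-].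
by rewrite ler_wpM2l//; apply: ubM; exists s.
Qed.

Lemma cvgn_norm_ubound (u : nat -> R^o) :
  cvgn u -> exists M : R, forall n, `|u n| <= M.
Proof.
move=> /cvg_seq_bounded /pinfty_ex_gt0[M _ uM].
by exists M => n; exact: uM.
Qed.

End sup_lemmas.

Section dual_type.
Context (R : realType) (X : normedModType R).

Definition continuous_linear : {pred X -> R^o} :=
  mem [set f : X -> R^o | linear f /\ continuous f].

Lemma continuous_linear_submod_closed : submod_closed continuous_linear.
Proof.
split; first by rewrite inE; split=> [a x y|x]; [rewrite scaler0 addr0|exact: cvg_cst].
move=> a f g /[!inE] -[fl fc] [gl gc]; split=> [b x y|x] /=.
  rewrite !fctE fl gl !scalerDr !scalerA (mulrC a b) -!addrA; congr (_ + _).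
  by rewrite !addrA; congr (_ + _); rewrite addrC.
by apply: cvgD; [apply: cvgZr; exact: fc|exact: gc].
Qed.

HB.instance Definition _ := GRing.isSubmodClosed.Build R (X -> R^o)
  continuous_linear continuous_linear_submod_closed.

Record dual := Dual {
  dual_val :> X -> R^o ;
  dual_valP : dual_val \in continuous_linear }.

HB.instance Definition _ := [isSub for dual_val].
HB.instance Definition _ := [Choice of dual by <:].
HB.instance Definition _ := [SubChoice_isSubLmodule of dual by <:].

Lemma dual_linear (f : dual) : linear f.
Proof. by have := dual_valP f; rewrite inE => -[]. Qed.

Lemma dual_continuous (f : dual) : continuous f.
Proof. by have := dual_valP f; rewrite inE => -[]. Qed.

HB.instance Definition _ (f : dual) :=
  GRing.isLinear.Build R X R^o *:%R f (dual_linear f).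

(* Meant for a subspace E and a continuous linear f, where the sup is that of a
   nonempty bounded set and equals the operator norm of the restriction of f to E. *)
Definition restr_norm (E : set X) (f : X -> R) : R :=
  sup [set `|f x| | x in E `&` [set x | `|x| <= 1]].

Lemma dual_ubound (f : dual) (E : set X) :
  has_ubound [set `|f x| | x in E `&` [set x | `|x| <= 1]].
Proof.
have [_ /(_ (@dual_continuous f))] := linear_bounded_continuous f.
move=> /linear_boundedP /pinfty_ex_gt0[M M0 fM].
exists M => _ [x [_ /= x1] <-]; apply: le_trans (fM x) _.
by rewrite -[leRHS]mulr1 ler_pM2l.
Qed.

Lemma dual_norm_bound (f : dual) x : `|f x| <= restr_norm setT f * `|x|.
Proof.
have [->|x0] := eqVneq x 0; first by rewrite linear0 !normr0 mulr0.
have nx : 0 < `|x| by rewrite normr_gt0.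
rewrite -ler_pdivrMr//; apply: ub_le_sup; first exact: dual_ubound.
exists (`|x|^-1 *: x) => /=.
  by split=> //; rewrite normrZ normfV normr_id mulVf// gt_eqF.
by rewrite linearZ/= normrZ normfV normr_id mulrC.
Qed.

Let nrm (f : dual) := restr_norm setT f.

Let nrm_ge0 f : 0 <= nrm f.
Proof.
apply: ub_le_sup; first exact: dual_ubound.
by exists 0; rewrite /= ?linear0 ?normr0.
Qed.

Let nrmD f g : nrm (f + g) <= nrm f + nrm g.
Proof.
apply: sup_le_ge0; first by rewrite addr_ge0.
move=> _ [x [_ /= x1] <-]; apply: le_trans (ler_normD _ _) _.
by apply: lerD; apply: ub_le_sup; [exact: dual_ubound|exists x|
  exact: dual_ubound|exists x].
Qed.

Let nrmZ a f : nrm (a *: f) = `|a| * nrm f.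
Proof.
rewrite /nrm /restr_norm -sup_image_scale//; last exact: dual_ubound.
- by congr sup; apply: eq_imagel => x _; exact: (normrM a).
- by exists 0; rewrite /= normr0.
Qed.

Let nrm_eq0 f : nrm f = 0 -> f = 0.
Proof.
move=> f0; apply/val_inj/funext => x; apply/eqP; rewrite -normr_le0.
by have := dual_norm_bound f x; rewrite -/(nrm f) f0 mul0r.
Qed.

HB.instance Definition _ := @Lmodule_isNormed.Build R dual nrm nrmD nrmZ nrm_eq0.

Lemma dual_normE (f : dual) : `|f| = restr_norm setT f. Proof. by []. Qed.

End dual_type.

Section reflexivity.
Context (R : realType) (X : normedModType R).

Lemma bidual_evalP (x : X) :
  (fun f : dual X => f x : R^o) \in @continuous_linear R (dual X).
Proof.
have lin : linear (fun f : dual X => f x : R^o) by [].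
rewrite inE; split=> //.
pose L := GRing.isLinear.Build R (dual X) R^o *:%R _ lin.
pose F : {linear dual X -> R^o} := HB.pack (fun f : dual X => f x : R^o) L.
apply: (@bounded_linear_continuous _ _ _ F); apply/linear_boundedP.
near=> r; move=> f; apply: (le_trans (dual_norm_bound f x)).
rewrite -dual_normE mulrC ler_wpM2r//; near: r.
by apply: nbhs_pinfty_ge; exact: num_real.
Unshelve. all: by end_near. Qed.

Definition bidual_eval (x : X) : dual (dual X) := Dual (bidual_evalP x).

Definition reflexive_space : Prop :=
  forall phi : dual (dual X), exists x, bidual_eval x = phi.

End reflexivity.

Section c0_space.
Context (R : realType).

Definition vanishing : {pred nat -> R^o} :=
  mem [set u : nat -> R^o | u @ \oo --> 0].

Lemma vanishing_submod_closed : submod_closed vanishing.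
Proof.
split; first by rewrite inE; exact: cvg_cst.
move=> a u v /[!inE] /= u0 v0.
have -> : 0 = a *: 0 + 0 :> R^o by rewrite scaler0 addr0.
by apply: cvgD => //; apply: cvgZr.
Qed.

HB.instance Definition _ := GRing.isSubmodClosed.Build R (nat -> R^o)
  vanishing vanishing_submod_closed.

Record c0 := C0 { c0_val :> nat -> R^o ; c0_valP : c0_val \in vanishing }.

HB.instance Definition _ := [isSub for c0_val].
HB.instance Definition _ := [Choice of c0 by <:].
HB.instance Definition _ := [SubChoice_isSubLmodule of c0 by <:].

Let nrm (u : c0) := sup (range (fun n => `|u n|)).

Let c0_ubound (u : c0) : has_ubound (range (fun n => `|u n|)).
Proof.
have := c0_valP u; rewrite inE /= => /cvgP/cvgn_norm_ubound[M uM].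
by exists M => _ [n _ <-]; exact: uM.
Qed.

Let nrm_ub (u : c0) n : `|u n| <= nrm u.
Proof. by apply: ub_le_sup => //; exists n. Qed.

Let nrmD u v : nrm (u + v) <= nrm u + nrm v.
Proof.
apply: ge_sup; first by exists `|(u + v) 0%N|; exists 0%N.
move=> _ [n _ <-]; apply: (le_trans (ler_normD _ _)).
by apply: lerD; exact: nrm_ub.
Qed.

Let nrmZ a u : nrm (a *: u) = `|a| * nrm u.
Proof.
rewrite /nrm -sup_image_scale; first last.
- exact: c0_ubound.
- by exists 0%N.
- exact: normr_ge0.
by congr (sup _); apply: eq_imagel => n _; exact: (normrM a).
Qed.

Let nrm_eq0 u : nrm u = 0 -> u = 0.
Proof.
move=> u0; apply/val_inj/funext => n; apply/eqP; rewrite -normr_le0.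
by rewrite -u0; exact: nrm_ub.
Qed.

HB.instance Definition _ := @Lmodule_isNormed.Build R c0 nrm nrmD nrmZ nrm_eq0.

Lemma c0_normE (u : c0) : `|u| = sup (range (fun n => `|u n|)).
Proof. by []. Qed.

End c0_space.

Section l1_space.
Context (R : realType).

Definition abs_summable : {pred nat -> R^o} :=
  mem [set u : nat -> R^o | cvgn (series (fun n => `|u n| : R^o))].

Let S (u : nat -> R^o) : nat -> R^o := series (fun n => `|u n| : R^o).

Let SZ a u : S (a *: u) = `|a| *: S u.
Proof.
apply/funext => n; rewrite -[RHS]/(`|a| *: (S u n)) /S /series /= scaler_sumr.
by apply: eq_bigr => i _; exact: (normrM a).
Qed.

Let SD u v n : S (u + v) n <= S u n + S v n.
Proof.
rewrite /S /series /= -big_split /=; apply: ler_sum => i _.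
exact: ler_normD.
Qed.

Let S_nd u : nondecreasing_seq (S u).
Proof. by apply: nondecreasing_series => n _ _; exact: normr_ge0. Qed.

Let S_cvgD u v : cvgn (S u) -> cvgn (S v) -> cvgn (S (u + v)).
Proof.
move=> cu cv; apply: nondecreasing_is_cvgn => //.
have [M uM] := cvgn_norm_ubound (is_cvgD cu cv).
exists M => _ [n _ <-]; apply: le_trans (SD u v n) _.
by apply: le_trans (ler_norm _) _; exact: uM.
Qed.

Let S_cvgZ a u : cvgn (S u) -> cvgn (S (a *: u)).
Proof. by move=> cu; rewrite SZ; exact: is_cvgZr. Qed.

Lemma abs_summable_submod_closed : submod_closed abs_summable.
Proof.
split.
  rewrite inE /= (_ : series _ = cst 0); first exact: is_cvg_cst.
  by apply/funext => n; rewrite /series /= big1// => i _; rewrite normr0.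
move=> a u v /[!inE] /= cu cv.
by apply: S_cvgD => //; exact: S_cvgZ.
Qed.

HB.instance Definition _ := GRing.isSubmodClosed.Build R (nat -> R^o)
  abs_summable abs_summable_submod_closed.

Record l1 := L1 { l1_val :> nat -> R^o ; l1_valP : l1_val \in abs_summable }.

HB.instance Definition _ := [isSub for l1_val].
HB.instance Definition _ := [Choice of l1 by <:].
HB.instance Definition _ := [SubChoice_isSubLmodule of l1 by <:].

Let nrm (u : l1) : R := limn (series (fun n => `|u n| : R^o)).

Let l1_cvg (u : l1) : cvgn (S u).
Proof. by have := l1_valP u; rewrite inE. Qed.

Let nrmD u v : nrm (u + v) <= nrm u + nrm v.
Proof.
have le_uv : \forall n \near \oo, S (u + v) n <= (S u + S v) n.
  by apply: nearW => n; exact: SD.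
have := ler_lim (@l1_cvg (u + v)) (is_cvgD (@l1_cvg u) (@l1_cvg v)) le_uv.
by rewrite (limD (@l1_cvg u) (@l1_cvg v)); exact.
Qed.

Let nrmZ a u : nrm (a *: u) = `|a| * nrm u.
Proof.
transitivity (limn (`|a| *: S u)); first by rewrite -SZ.
exact: (limZr `|a| (@l1_cvg u)).
Qed.

Let nrm_eq0 u : nrm u = 0 -> u = 0.
Proof.
move=> u0; apply/val_inj/funext => n; apply/eqP; rewrite -normr_le0 -u0.
apply: le_trans (nondecreasing_cvgn_le (@S_nd u) (@l1_cvg u) n.+1).
rewrite /S /series /= big_nat_recr//= lerDr.
by apply: sumr_ge0 => i _.
Qed.

HB.instance Definition _ := @Lmodule_isNormed.Build R l1 nrm nrmD nrmZ nrm_eq0.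

Lemma l1_normE (u : l1) : `|u| = limn (series (fun n => `|u n| : R^o)).
Proof. by []. Qed.

End l1_space.

(* T is a linear isomorphism of E onto its (not necessarily complemented) range. *)
Definition contains_copy (R : realType) (X E : normedModType R) : Prop :=
  exists (T : {linear E -> X}) (a b : R),
    [/\ 0 < a, 0 < b & forall u, a * `|u| <= `|T u| <= b * `|u|].

Definition separable_space (T : topologicalType) : Prop :=
  exists2 D : set T, countable D & dense D.

Definition unconditionally_cvg (R : realType) (X : normedModType R)
    (y : nat -> X) : Prop :=
  forall s : nat -> nat, bijective s -> cvgn (series (y \o s)).

Section frames.
Context (R : realType) (X : normedModType R).
Variables (x : nat -> X) (f : nat -> dual X).

Definition schauder_frame : Prop :=
  (forall i, x i != 0 /\ f i != 0) /\
  (forall z, series (fun i => f i z *: x i) @ \oo --> z).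

Definition unconditional_frame : Prop :=
  schauder_frame /\ forall z, unconditionally_cvg (fun i => f i z *: x i).

End frames.

Definition lin_span (R : realType) (X : lmodType R) (A : set X) : set X :=
  [set v | exists s : seq (R * X),
    (forall p, p \in s -> A p.2) /\ v = \sum_(p <- s) p.1 *: p.2].

(* Main.v *)
From HB Require Import structures.
Require Import Defs.
From mathcomp Require Import all_boot all_order all_algebra.
From mathcomp Require Import all_classical all_reals.
From mathcomp Require Import topology normedtype sequences.
From mathcomp Require Import lra zify.
Import Order.TTheory GRing.Theory Num.Theory.
Import numFieldNormedType.Exports.
Local Open Scope classical_set_scope.
Local Open Scope ring_scope.

(** Sufficiency of the two exclusions.  Unconditional convergence of
    [sum_i f_i(z) x_i] bounds all its finite partial sums (a rearrangement
    argument), and uniform boundedness upgrades this to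
    [sum_i |g(x_i) f_i(z)| <= K |g| |z|] for [g] in [X*] and [z] in [X]
    ([frame_abs_sum_le]), and then to
    [sum_i |phi(f_i) g(x_i)| <= K |phi| |g|] for [phi] in [X**]
    ([frame_bidual_abs_sum_le]).
    So for every [g] the series [sum_i g(x_i) f_i] in [X*], and for every [phi]
    the series [sum_i phi(f_i) x_i] in [X], are weakly unconditionally Cauchy.
    If one of them is not norm-Cauchy it has disjoint blocks whose norms stay
    away from 0.  A subsequence of such blocks in [X] spans a copy of [c_0]
    ([contains_c0]); for blocks in [X*], a subsequence of vectors of [X] that
    almost norm them spans a copy of [l_1] ([contains_l1]).  In both cases
    Rosenthal's disjointification ([rosenthal_disjoint]) makes the matrix of
    functionals against vectors nearly diagonal along a subsequence.
    Without copies of [c_0] and [l_1], both series therefore converge, the first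
    one to [g]; and [x := sum_i phi(f_i) x_i] represents [phi], because
    [phi(g) = sum_i g(x_i) phi(f_i) = g(x)].

    Necessity.  In a reflexive space a bounded sequence [w_n] has a point [z]
    with [g(z) = lim g(w_n)] whenever that limit exists
    ([reflexive_weak_cluster]).  Through an embedding [T : E -> X] and
    Hahn-Banach, a bounded sequence of [E] inherits such a point up to any
    [e > 0], uniformly over the unit ball of [E*]
    ([reflexive_copy_weak_cluster]).  The sums [e_0 + ... + e_(n-1)] in [c_0]
    and the unit vectors [e_n] in [l_1] have none.

    Hahn-Banach is proved in the form: a minimal sublinear functional is
    linear. *)

(** * The Hahn-Banach theorem *)

Definition sublinear {R : realType} {V : lmodType R} (p : V -> R) : Prop :=
  (forall x y, p (x + y) <= p x + p y) /\
  (forall (t : R) x, 0 < t -> p (t *: x) <= t * p x).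

Section HahnBanach.
Context {R : realType} {V : lmodType R}.
Implicit Types (p q : V -> R).

Lemma sublinear0 p : sublinear p -> p 0 = 0.
Proof.
move=> [pD pZ]; have := pD 0 0; have := pZ 2^-1 0; rewrite addr0 scaler0.
by rewrite invr_gt0 ltr0n => /(_ isT); lra.
Qed.

Lemma sublinearZ p t x : sublinear p -> 0 <= t -> p (t *: x) = t * p x.
Proof.
move=> sp; rewrite le_eqVlt => /predU1P[<-|t0].
  by rewrite scale0r sublinear0// mul0r.
apply/eqP; rewrite eq_le sp.2//= -ler_pdivlMl//.
have : p (t^-1 *: (t *: x)) <= t^-1 * p (t *: x) by rewrite sp.2// invr_gt0.
by rewrite scalerA mulVf ?gt_eqF// scale1r.
Qed.

Lemma sublinear_ge p x : sublinear p -> - p (- x) <= p x.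
Proof.
by move=> sp; have := sp.1 x (- x); rewrite subrr sublinear0//; lra.
Qed.

(** Every sublinear functional below is obtained as a pointwise infimum of a
    family that need not consist of sublinear functionals: the inequalities may
    hold with a change of index. *)
Lemma inf_sublinear (I : Type) (i0 : I) (h : I -> V -> R) :
    (forall x, exists m, forall i, m <= h i x) ->
    (forall i j x y, exists k, h k (x + y) <= h i x + h j y) ->
    (forall i (t : R) x, 0 < t -> exists k, h k (t *: x) <= t * h i x) ->
  sublinear (fun x => inf (range (h^~ x))) /\
  forall i x, inf (range (h^~ x)) <= h i x.
Proof.
move=> hlb hD hZ; pose p x := inf (range (h^~ x)).
have ple i x : p x <= h i x.
  by apply: ge_inf; [have [m mh] := hlb x; exists m => _ [j _ <-]|exists i].
have pge m x : (forall i, m <= h i x) -> m <= p x.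
  by move=> mh; apply: lb_le_inf; [exists (h i0 x), i0|move=> _ [i _ <-]].
split=> //; split=> [x y|t x t0].
  rewrite -lerBlDr; apply: (pge) => i; rewrite lerBlDl -lerBlDr.
  apply: (pge) => j; rewrite lerBlDl addrC.
  by have [k hk] := hD i j x y; rewrite (le_trans (ple k _))// addrC.
rewrite mulrC -ler_pdivrMr//; apply: (pge) => i; rewrite ler_pdivrMr// mulrC.
by have [k hk] := hZ i t x t0; exact: le_trans (ple k _) hk.
Qed.

(** The largest sublinear [q <= p] with [q (- y) <= - p y].  It forces additivity
    of a minimal [p], and it is also what makes a dominated linear functional
    attain [p y]. *)
Lemma sublinear_shift p y : sublinear p ->
  exists q, [/\ sublinear q, forall x, q x <= p x &
                forall x (t : R), 0 <= t -> q x <= p (x + t *: y) - t * p y].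
Proof.
move=> sp; have [pD pZ] := sp.
pose h (t : {x : R | 0 <= x}) x := p (x + val t *: y) - val t * p y.
pose t0 : {x : R | 0 <= x} := exist _ 0 (lexx 0).
have [|||sq qle] := @inf_sublinear _ t0 h.
- move=> x; exists (- p (- x)) => -[t /= t_ge0]; rewrite /h /=.
  have := pD (x + t *: y) (- x); rewrite addrAC subrr add0r.
  by rewrite sublinearZ//; lra.
- move=> [s /= s0] [t /= t_ge0] x z; exists (exist _ (s + t) (addr_ge0 s0 t_ge0)).
  rewrite /h /= scalerDl addrACA; have := pD (x + s *: y) (z + t *: y); lra.
- move=> [s /= s0] t x t_gt0.
  exists (exist _ (t * s) (mulr_ge0 (ltW t_gt0) s0)); rewrite /h /=.
  by rewrite -scalerA -scalerDr mulrBr mulrA lerD2r pZ.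
exists (fun x => inf (range (h^~ x))); split=> // [x|x t t_ge0].
  by have := qle t0 x; rewrite /h /= scale0r addr0 mul0r subr0.
exact: qle (exist _ t t_ge0) x.
Qed.

(** Zorn's lemma; the infimum of a chain is sublinear, and it is finite because
    [- p (- x)] bounds every member of the chain from below. *)
Lemma sublinear_minimal p : sublinear p ->
  exists q, [/\ sublinear q, forall x, q x <= p x &
    forall r, sublinear r -> (forall x, r x <= q x) -> r = q].
Proof.
move=> sp; pose T := {q : V -> R | sublinear q /\ forall x, q x <= p x}.
pose below (s t : T) := `[< forall x, sval t x <= sval s x >].
have [||||[q [sq qp]] qmin] := @Zorn T below.
- by move=> t; apply/asboolP.
- move=> r s t /asboolP rs /asboolP st; apply/asboolP => x.
  exact: le_trans (st x) (rs x).
- move=> [s sP] [t tP] /asboolP /= ts /asboolP /= st.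
  by apply: eq_exist; apply/funext => x; apply/eqP; rewrite eq_le ts st.
- move=> C Ctot; have [[c0 Cc0]|C0] := pselect (exists t, C t); last first.
    by exists (exist _ p (conj sp (fun x => lexx (p x)))) => s Cs; case: C0; exists s.
  pose h (i : {t : T | C t}) x := sval (sval i) x.
  have [|||sq qle] := @inf_sublinear _ (exist _ c0 Cc0) h.
  + move=> x; exists (- p (- x)) => -[[q /= [sq qp]] Cq].
    by rewrite /h /=; have := sublinear_ge q x sq; have := qp (- x); lra.
  + move=> i j x y; have [/asboolP ij|/asboolP ji] := Ctot _ _ (svalP i) (svalP j).
      exists j; rewrite (le_trans ((svalP (sval j)).1.1 _ _))// lerD2r; exact: ij.
    exists i; rewrite (le_trans ((svalP (sval i)).1.1 _ _))// lerD2l; exact: ji.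
  + by move=> i t x t0; exists i; exact: (svalP (sval i)).1.2.
  have qp x : inf (range (h^~ x)) <= p x.
    exact: le_trans (qle (exist _ c0 Cc0) x) ((svalP c0).2 x).
  exists (exist _ (fun x => inf (range (h^~ x))) (conj sq qp)) => s Cs.
  by apply/asboolP => x; exact: qle (exist _ s Cs) x.
exists q; split=> // r sr rq.
have rT : sublinear r /\ forall x, r x <= p x.
  by split=> // x; apply: le_trans (rq x) (qp x).
have /= := qmin (exist _ r rT); rewrite /below => /(_ (introT (asboolP _) rq)).
by case.
Qed.

(** A minimal functional [q] coincides with its shift by [z], so that
    [q x <= q (x + z) - q z]: it is superadditive, hence linear.  Starting the
    descent from the shift of [p] by [y] keeps the value at [y]. *)
Lemma hahn_banach_sublinear p y : sublinear p ->
  exists g : V -> R^o, [/\ linear g, forall x, g x <= p x & g y = p y].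
Proof.
move=> sp; have [p' [sp' p'p p'y]] := sublinear_shift p y sp.
have [q [sq qp' qmin]] := sublinear_minimal p' sp'.
have qD x z : q (x + z) = q x + q z.
  apply/eqP; rewrite eq_le sq.1 /=.
  have [r [sr rq rz]] := sublinear_shift q z sq.
  have rE := qmin _ sr rq; have := rz x 1 ler01.
  by rewrite rE scale1r mul1r; lra.
have qN x : q (- x) = - q x.
  by have := qD x (- x); rewrite subrr sublinear0//; lra.
have qZ (t : R) x : q (t *: x) = t * q x.
  have [t0|t0] := leP 0 t; first exact: sublinearZ.
  by rewrite -[t]opprK scaleNr qN sublinearZ// ?oppr_ge0 ?ltW//; lra.
exists q; split=> [a x z|x|]; first by rewrite qD qZ.
  exact: le_trans (qp' x) (p'p x).
apply/eqP; rewrite eq_le (le_trans (qp' y) (p'p y))/=.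
have := le_trans (qp' (- y)) (p'y (- y) 1 ler01).
by rewrite scale1r addNr sublinear0// qN; lra.
Qed.

End HahnBanach.

Section dual_functionals.
Context {R : realType} {X : normedModType R}.

Lemma dual_eval_le (f : dual X) v :
  `|f v| <= `|f| * `|v|.
Proof. by rewrite dual_normE; exact: dual_norm_bound. Qed.

Lemma dual_sumE (I : Type) (r : seq I)
    (P : pred I) (F : I -> dual X) v :
  (\sum_(i <- r | P i) F i) v = \sum_(i <- r | P i) F i v.
Proof. by apply: (big_morph (fun h : dual X => h v)). Qed.

Lemma dual_norm_le (f : dual X) (C : R) :
  0 <= C -> (forall z, `|f z| <= C * `|z|) -> `|f| <= C.
Proof.
move=> C0 fC; rewrite dual_normE; apply: sup_le_ge0 => // _ [z [_ /= z1] <-].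
by rewrite (le_trans (fC z))// -[leRHS]mulr1 ler_wpM2l.
Qed.

Lemma dual_norm_witness (h : dual X) (d : R) : 0 < d -> d < `|h| ->
  exists2 z, `|z| <= 1 & d <= `|h z|.
Proof.
move=> d0 dh; apply: contrapT => nz; move: dh; rewrite ltNge => /negP; apply.
rewrite dual_normE; apply: sup_le_ge0; first exact: ltW.
move=> _ [z [_ /= z1] <-]; rewrite leNgt; apply/negP => lt.
by apply: nz; exists z => //; exact: ltW.
Qed.

Lemma dual_of_bounded (g : X -> R^o) (C : R) : 0 <= C -> linear g ->
  (forall z, g z <= C * `|z|) -> exists2 G : dual X, G =1 g & `|G| <= C.
Proof.
move=> C0 lg gC.
pose g' : {linear X -> R^o} := HB.pack g (GRing.isLinear.Build _ _ _ _ _ lg).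
have gN z : g (- z) = - g z := linearN g' z.
have gC' z : `|g z| <= C * `|z|.
  rewrite ler_norml gC andbT lerNl.
  by have := gC (- z); rewrite normrN gN.
have gP : g \in @continuous_linear R X.
  rewrite inE; split=> //; apply: (@bounded_linear_continuous _ _ _ g').
  apply/linear_boundedP; near=> r => z; apply: le_trans (gC' z) _.
  by rewrite ler_wpM2r//; near: r; apply: nbhs_pinfty_ge; exact: num_real.
by exists (Dual gP) => //; exact: dual_norm_le.
Unshelve. all: by end_near. Qed.

(** Extension and separation in one statement, by Hahn-Banach for the functional
    [z |-> inf_u (l u + C |z - T u|)]: the functional [l], carried to the range of
    [T], extends to [X] with norm at most [C], and at a prescribed point [x0] the
    extension takes its largest possible value.  With [l = 0] that value is
    [C] times the distance of [x0] to the range of [T]. *)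
Lemma hahn_banach_through {E : lmodType R} (T : {linear E -> X})
    (l : E -> R^o) (C : R) x0 : linear l -> 0 <= C ->
    (forall u, `|l u| <= C * `|T u|) ->
  exists g : dual X, [/\ `|g| <= C, forall u, g (T u) = l u &
    forall c, (forall u, c <= l u + C * `|x0 - T u|) -> c <= g x0].
Proof.
move=> ll C0 lC.
pose l' : {linear E -> R^o} := HB.pack l (GRing.isLinear.Build _ _ _ _ _ ll).
have lD u v : l (u + v) = l u + l v := linearD l' u v.
have lN u : l (- u) = - l u := linearN l' u.
have lZ (t : R) u : l (t *: u) = t * l u := linearZ_LR l' t u.
have l0 : l 0 = 0 := linear0 l'.
pose h u z := l u + C * `|z - T u|.
have [|||sp pleh] := @inf_sublinear _ _ _ (0 : E) h.
- move=> z; exists (- (C * `|z|)) => u; rewrite /h.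
  have := lC u; rewrite ler_norml => /andP[+ _].
  suff : C * `|T u| <= C * `|z - T u| + C * `|z| by lra.
  rewrite -mulrDr ler_wpM2l// [leLHS](_ : _ = `|(z - T u) - z|).
    exact: ler_normB.
  by rewrite addrAC subrr add0r normrN.
- move=> u v z w; exists (u + v); rewrite /h lD linearD opprD [z + w + _]addrACA.
  rewrite [leRHS]addrACA lerD2l -mulrDr ler_wpM2l//; exact: ler_normD.
- move=> u t z t0; exists (t *: u); rewrite /h lZ linearZ /= -scalerBr normrZ.
  by rewrite gtr0_norm// mulrDr mulrCA.
have [g [lg gp gx0]] := hahn_banach_sublinear _ x0 sp.
have [z|G Gg GC] := dual_of_bounded _ _ C0 lg.
  by rewrite (le_trans (gp z))// (le_trans (pleh 0 z))// /h l0 linear0 subr0 add0r.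
have GT u : G (T u) <= l u.
  by rewrite Gg (le_trans (gp _))// (le_trans (pleh u _))// /h subrr normr0 mulr0 addr0.
exists G; split=> // [u|c cle].
  apply/eqP; rewrite eq_le GT /=.
  by have := GT (- u); rewrite lN !linearN lerN2.
rewrite Gg gx0; apply: lb_le_inf; first by exists (h 0 x0), 0.
by move=> _ [u _ <-]; exact: cle.
Qed.

Lemma norming_functional (z : X) : exists2 g : dual X, `|g| <= 1 & g z = `|z|.
Proof.
have [|||g [g1 _ gz]] := @hahn_banach_through X \0 (\0 : X -> R^o) 1 z.
- by move=> a u v; rewrite /= scaler0 addr0.
- by [].
- by move=> u /=; rewrite !normr0 mulr0.
exists g => //; apply/eqP; rewrite eq_le gz => [|u]; last first.
  by rewrite /= subr0 mul1r add0r.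
rewrite andbT (le_trans (ler_norm _))// (le_trans (dual_norm_bound g z))//.
by rewrite -dual_normE ler_piMl.
Qed.

End dual_functionals.

(** * Rosenthal's disjointification *)

Section Rosenthal.
Context {R : realType}.
Implicit Types (u : nat -> R) (c : nat -> nat -> R).

Lemma uniq_sum_le u (B : R) : (forall i, 0 <= u i) ->
    (forall n, \sum_(0 <= i < n) u i <= B) ->
  forall s, uniq s -> \sum_(i <- s) u i <= B.
Proof.
move=> u0 uB s us; pose n := (\max_(i <- s) i).+1.
apply: le_trans (uB n).
have sE : perm_eq s [seq i <- index_iota 0 n | i \in s].
  apply: uniq_perm => // [|i]; first by rewrite filter_uniq// iota_uniq.
  rewrite mem_filter mem_index_iota /=; case: (boolP (i \in s)) => //= si.
  by rewrite ltnS; apply/esym/(@leq_bigmax_seq _ s xpredT id).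
by rewrite (perm_big _ sE) big_filter [leRHS](bigID (mem s))/= lerDl sumr_ge0.
Qed.

(** [disjoint_at p] enumerates the [p]-th set of a partition of a part of [nat]
   into infinitely many infinite sets. *)
Let disjoint_at (p i : nat) : nat := pickle (p, i).

Let disjoint_at_inj p i q j : disjoint_at p i = disjoint_at q j -> p = q /\ i = j.
Proof. by move=> /(pcan_inj pickleK)[]. Qed.

(** Induction on the number [N] of times [e] fits into the bound on the row sums.
    Split the indices into infinitely many infinite sets.  If one of them has small
    off-diagonal row sums it is the answer.  Otherwise each set contains a row
    with off-diagonal sum above [e] inside that set; selecting this one row in
    every set leaves rows whose mass outside the selection is more than [e], so
    that the bound on the row sums over the selection drops by [e]. *)
Lemma rosenthal_disjoint c (B e : R) : 0 < e -> (forall k j, 0 <= c k j) ->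
    (forall k s, uniq s -> \sum_(j <- s) c k j <= B) ->
  exists2 t : nat -> nat, injective t & forall k s, uniq s -> k \notin s ->
    \sum_(j <- s) c (t k) (t j) <= e.
Proof.
move=> e0 c0 cB; pose N := (Num.truncn (B / e)).+1.
have {cB} : forall k s, uniq s -> \sum_(j <- s) c k j <= e *+ N.
  move=> k s us; apply: (le_trans (cB k s us)).
  by rewrite -mulr_natl -ler_pdivrMr// ltW// truncnS_gt.
elim: N c c0 => [|N IH] c c0 cN.
  exists id => // k s us ks; apply: le_trans (cN k s us) _.
  by rewrite mulr0n ltW.
pose good p := forall k s, uniq s -> k \notin s ->
  \sum_(j <- s) c (disjoint_at p k) (disjoint_at p j) <= e.
have [[p gp]|bad] := pselect (exists p, good p).
  by exists (disjoint_at p) => // i j /disjoint_at_inj[].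
have : forall p, exists ks : nat * seq nat, [/\ uniq ks.2, ks.1 \notin ks.2 &
    e < \sum_(j <- ks.2) c (disjoint_at p ks.1) (disjoint_at p j)].
  move=> p; apply: contrapT => np; apply: bad; exists p => k s us ks.
  by rewrite leNgt; apply/negP => lt; apply: np; exists (k, s).
move=> /choice[ks ksP]; pose t p := disjoint_at p (ks p).1.
have t_inj : injective t by move=> p q /disjoint_at_inj[].
have [|k s us|t' t'_inj t'P] := IH (fun k j => c (t k) (t j)).
- by move=> k j; exact: c0.
- have [usk knk lt] := ksP k.
  have := cN (t k) (map t s ++ map (disjoint_at k) (ks k).2).
  rewrite big_cat/= !big_map mulrSr => /(_ _)/wrap[|].
    rewrite cat_uniq !map_inj_uniq ?us ?usk ?andbT//=; last first.
      by move=> i j /disjoint_at_inj[].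
    apply/hasPn => _ /mapP[i ki ->]; apply/mapP => -[j sj /disjoint_at_inj[kj ij]].
    by move: knk; rewrite kj -ij -kj ki.
  by rewrite /t => h; move: lt h; rewrite -/(t k); lra.
by exists (t \o t'); [exact: inj_comp|].
Qed.

End Rosenthal.

(** * Copies of the classical sequence spaces *)

Section normed_sequences.
Context {R : realType}.

Lemma series_cauchyP {V : normedModType R} (y : nat -> V) :
    cauchy (series y @ \oo) <->
  forall e : R, 0 < e -> exists N, forall m n, (N <= m)%N -> (m <= n)%N ->
    `|\sum_(m <= i < n) y i| <= e.
Proof.
rewrite cauchy_seriesP; split=> [yC e e0|yC e e0].
  have [[/= A B] [[a _ aA] [b _ bB]] AB] := yC e e0.
  exists (maxn a b) => m n; rewrite geq_max => /andP[am bm] mn; apply: ltW.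
  by apply: (AB (m, n)); split=> /=; [exact: aA|apply: bB; exact: leq_trans mn].
have [N NP] := yC (e / 2) (divr_gt0 e0 (ltr0Sn _ _)).
exists ([set n | (N <= n)%N], [set n | (N <= n)%N]); first by split; exists N.
move=> [m n] /= [Nm Nn]; have [mn|/ltnW nm] := leqP m n.
  by rewrite (le_lt_trans (NP _ _ Nm mn))// ltr_pdivrMr// ltr_pMr// ltr1n.
by rewrite big_geq// normr0.
Qed.

Lemma cvg_le_norm {V : normedModType R} (u : nat -> V) (l : V) (B : R) N :
  u @ \oo --> l -> (forall n, (N <= n)%N -> `|u n| <= B) -> `|l| <= B.
Proof.
move=> /cvg_norm ul uB.
by apply: (cvgr_to_le ul); exists N.
Qed.

Lemma cvg_ge_norm {V : normedModType R} (u : nat -> V) (l : V) (B : R) N :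
  u @ \oo --> l -> (forall n, (N <= n)%N -> B <= `|u n|) -> B <= `|l|.
Proof.
move=> /cvg_norm ul uB.
by apply: (cvgr_to_ge ul); exists N.
Qed.

End normed_sequences.

Section copy_of_c0.
Context {R : realType} {X : completeNormedModType R}.

(** In the embeddings of [c_0] and [l_1], [co] maps an element to its
    coordinates. *)
Lemma synthesis_linear (E : lmodType R) (co : E -> nat -> R^o) (y : nat -> X) :
    linear co -> (forall a, cauchy (series (fun j => co a j *: y j) @ \oo)) ->
  exists T : {linear E -> X},
    forall a, series (fun j => co a j *: y j) @ \oo --> T a.
Proof.
move=> lco coC.
have cv a : cvgn (series (fun j => co a j *: y j)).
  by apply: cauchy_cvg; exact: coC.
pose T a := limn (series (fun j => co a j *: y j)).
have lT : linear T.
  move=> k a b; apply/cvg_lim => //.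
  rewrite (_ : (fun j => _) = k *: (fun j => co a j *: y j) +
                             (fun j => co b j *: y j)); last first.
    by apply/funext => j; rewrite lco /= !fctE scalerDl scalerA.
  by rewrite seriesD seriesZ; apply: cvgD; [apply: cvgZr|]; exact: cv.
pose T' : {linear E -> X} := HB.pack T (GRing.isLinear.Build _ _ _ _ _ lT).
by exists T' => a; exact: cv.
Qed.

Lemma c0_le_norm (a : c0 R) j : `|a j| <= `|a|.
Proof.
rewrite c0_normE; apply: ub_le_sup; last by exists j.
have := c0_valP a; rewrite inE /= => /cvgP/cvgn_norm_ubound[M aM].
by exists M => _ [n _ <-]; exact: aM.
Qed.

(** Let [g_k] norm [y_k].  The matrix [|g_k (y_j)|] has bounded row sums; along a
    subsequence its off-diagonal row sums are at most [d / 2], while its diagonal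
    is at least [d].  So [g_k] detects the coordinate [a_k] of
    [sum_j a_j y_j] up to the error [|a| d / 2], which gives the lower bound
    [|a| d / 2]; the upper bound is the hypothesis on [y]. *)
Lemma contains_c0 (y : nat -> X) (M d : R) : 0 < d ->
    (forall (g : dual X) n, \sum_(0 <= k < n) `|g (y k)| <= M * `|g|) ->
    (forall k, d <= `|y k|) ->
  contains_copy X (c0 R).
Proof.
move=> d0 yM dy.
have M0 : 0 <= M.
  have [g g1 gy] := norming_functional (y 0%N).
  have := yM g 0%N; rewrite big_geq// => Mg.
  rewrite leNgt; apply/negP => Mlt; move: Mg; apply/negP; rewrite -ltNge.
  rewrite nmulr_rlt0// normr_gt0; apply/eqP => g0.
  by have := dy 0%N; rewrite -gy g0 /=; apply/negP; rewrite -ltNge.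
have /choice[g gP] k : exists g : dual X, `|g| <= 1 /\ g (y k) = `|y k|.
  by have [g g1 gy] := norming_functional (y k); exists g.
have sM (h : dual X) s : `|h| <= 1 -> uniq s -> \sum_(k <- s) `|h (y k)| <= M.
  move=> h1; apply: uniq_sum_le => // n; apply: le_trans (yM h n) _.
  by rewrite -[leRHS]mulr1 ler_wpM2l.
have d20 : 0 < d / 2 by rewrite divr_gt0.
have [t t_inj tP] := @rosenthal_disjoint R (fun k j => `|g k (y j)|) M _ d20
  (fun k j => normr_ge0 _) (fun k s => sM (g k) s (gP k).1).
pose z := y \o t.
(* The upper estimate, on arbitrary segments so that it also yields convergence. *)
have zM (a : nat -> R) m n B : (forall j, (m <= j < n)%N -> `|a j| <= B) -> 0 <= B ->
    `|\sum_(m <= j < n) a j *: z j| <= B * M.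
  move=> aB B0; have [h h1 <-] := norming_functional (\sum_(m <= j < n) a j *: z j).
  rewrite linear_sum/=; apply: le_trans (ler_norm _) _.
  apply: le_trans (ler_norm_sum _ _ _) _.
  apply: (@le_trans _ _ (\sum_(m <= j < n) B * `|h (z j)|)).
    rewrite !big_nat; apply: ler_sum => j /aB aj.
    by rewrite linearZ/= normrM ler_wpM2r.
  rewrite -mulr_sumr ler_wpM2l//.
  have := sM h (map t (index_iota m n)) h1; rewrite big_map; apply.
  by rewrite map_inj_uniq// iota_uniq.
have [|a|T Tlim] := @synthesis_linear (c0 R) (@c0_val R) z.
- by [].
- apply/series_cauchyP => e e0.
  have e'0 : 0 < e / (M + 1) by rewrite divr_gt0// ltr_wpDl.
  have := c0_valP a; rewrite inE /= => /cvgrPdist_le/(_ _ e'0)[N _ NP].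
  exists N => m n Nm mn; apply: le_trans (zM _ _ _ (e / (M + 1)) _ (ltW e'0)) _.
    move=> j /andP[mj _]; have := NP j (leq_trans Nm mj).
    by rewrite sub0r normrN.
  by rewrite mulrAC ler_pdivrMr ?ltr_wpDl// ler_wpM2l// ?ltW// ltrDl.
exists T, (d / 2), (M + 1); split=> // [|a]; first by rewrite ltr_wpDl.
apply/andP; split; last first.
  rewrite mulrDl mul1r; apply: (@le_trans _ _ (`|a| * M)); last first.
    by rewrite mulrC lerDl.
  by apply: (cvg_le_norm _ _ _ 0%N (Tlim a)) => n _; apply: zM => // j _; exact: c0_le_norm.
have [a0|a0] := eqVneq a 0; first by rewrite a0 linear0 normr0 mulr0.
suff main k : `|a k| * d <= `|T a| + `|a| * (d / 2).
  have : `|a| <= (`|T a| + `|a| * (d / 2)) / d.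
    rewrite [leLHS]c0_normE; apply: ge_sup; first by exists `|a 0%N|, 0%N.
    by move=> _ [k _ <-]; rewrite ler_pdivlMr.
  by rewrite ler_pdivlMr//; lra.
rewrite -lerBlDr; apply: (@cvg_ge_norm _ _ _ _ _ k.+1 (Tlim a)) => n kn.
apply: le_trans (_ : `|g (t k) (series (fun j => a j *: z j) n)| <= _); last first.
  apply: le_trans (dual_norm_bound _ _) _; rewrite -dual_normE.
  by rewrite ler_piMl//; exact: (gP _).1.
rewrite /series/= linear_sum/= (bigD1_seq k)/= ?mem_index_iota ?iota_uniq//.
have diag : `|a k| * d <= `|g (t k) (a k *: z k)|.
  by rewrite linearZ/= normrM ler_wpM2l// (gP _).2 ger0_norm.
have offdiag : `|\sum_(0 <= j < n | j != k) g (t k) (a j *: z j)| <= `|a| * (d / 2).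
  apply: le_trans (ler_norm_sum _ _ _) _.
  apply: (@le_trans _ _ (\sum_(0 <= j < n | j != k) `|a| * `|g (t k) (z j)|)).
    by apply: ler_sum => j _; rewrite linearZ/= normrM ler_wpM2r// c0_le_norm.
  rewrite -mulr_sumr ler_wpM2l//.
  rewrite -big_filter; apply: tP; first by rewrite filter_uniq// iota_uniq.
  by rewrite mem_filter eqxx.
by apply: le_trans (lerB_normD _ _); rewrite lerB.
Qed.

End copy_of_c0.

Section copy_of_l1.
Context {R : realType} {X : completeNormedModType R}.

Lemma l1_partial_le_norm (a : l1 R) n : \sum_(0 <= j < n) `|a j| <= `|a|.
Proof.
rewrite l1_normE; apply: (@nondecreasing_cvgn_le _ (series (fun j => `|a j|))).
  by apply: nondecreasing_series => j _ _.
by have := l1_valP a; rewrite inE.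
Qed.

(** The matrix [|h_k (z_j)|] has bounded sums over [k].  After
    disjointification, summing [|h_k (sum_j a_j z_j)|] over [k] keeps at least
    [d sum_k |a_k|] from the diagonal and loses at most [d / 2 sum_j |a_j|] off
    the diagonal, while the hypothesis on [h] bounds the sum by
    [M |sum_j a_j z_j|]. *)
Lemma contains_l1 (z : nat -> X) (h : nat -> dual X) (M d : R) : 0 < d ->
    (forall v n, \sum_(0 <= k < n) `|h k v| <= M * `|v|) ->
    (forall k, `|z k| <= 1) -> (forall k, d <= `|h k (z k)|) ->
  contains_copy X (l1 R).
Proof.
move=> d0 hM z1 dh.
have M0 : 0 < M.
  have := hM (z 0%N) 1%N; rewrite big_nat1 => /(le_trans (dh 0%N)) dM.
  have := lt_le_trans d0 dM; rewrite pmulr_lgt0// normr_gt0.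
  by apply/eqP => z0; move: (lt_le_trans d0 dM); rewrite z0 normr0 mulr0 ltxx.
have sM v s : uniq s -> \sum_(k <- s) `|h k v| <= M * `|v|.
  by apply: uniq_sum_le => // n; exact: hM.
have d20 : 0 < d / 2 by rewrite divr_gt0.
have rowM j s : uniq s -> \sum_(k <- s) `|h k (z j)| <= M.
  by move=> us; apply: le_trans (sM _ _ us) _; rewrite ger_pMr.
have [t t_inj tP] := @rosenthal_disjoint R (fun j k => `|h k (z j)|) M _ d20
  (fun j k => normr_ge0 _) rowM.
pose y := z \o t.
have y_le (a : nat -> R) m n :
    `|\sum_(m <= j < n) a j *: y j| <= \sum_(m <= j < n) `|a j|.
  apply: le_trans (ler_norm_sum _ _ _) _; apply: ler_sum => j _.
  by rewrite normrZ -[leRHS]mulr1 ler_wpM2l//; exact: z1.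
have [|a|T Tlim] := @synthesis_linear _ X (l1 R) (@l1_val R) y.
- by [].
- apply/series_cauchyP => e e0.
  have /cvg_cauchy/series_cauchyP : cvgn (series (fun j => `|a j| : R^o)).
    by have := l1_valP a; rewrite inE.
  move=> /(_ e e0)[N NP]; exists N => m n Nm mn.
  apply: le_trans (y_le _ _ _) _; apply: le_trans (NP m n Nm mn).
  exact: ler_norm.
exists T, (d / 2 / M), 1; split=> // [|a]; first by rewrite divr_gt0.
apply/andP; split; last first.
  rewrite mul1r; apply: (cvg_le_norm _ _ _ 0%N (Tlim a)) => n _.
  exact: le_trans (y_le _ _ _) (l1_partial_le_norm _ _).
have lower n : (\sum_(0 <= j < n) `|a j|) * (d / 2) <=
    M * `|series (fun j => a j *: y j) n|.
  set S := series _ n.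
  apply: le_trans (_ : \sum_(0 <= k < n) `|h (t k) S| <= _); last first.
    have := sM S (map t (index_iota 0 n)); rewrite big_map; apply.
    by rewrite map_inj_uniq// iota_uniq.
  have hS k : (k < n)%N -> `|a k| * d -
      \sum_(0 <= j < n | j != k) `|a j| * `|h (t k) (y j)| <= `|h (t k) S|.
    move=> kn; rewrite /S /series /= [X in _ <= `|X|]linear_sum/=.
    rewrite (bigD1_seq k)/= ?mem_index_iota ?iota_uniq//.
    have diag : `|a k| * d <= `|h (t k) (a k *: y k)|.
      by rewrite linearZ/= normrM ler_wpM2l//; exact: dh.
    have offdiag : `|\sum_(0 <= j < n | j != k) h (t k) (a j *: y j)| <=
        \sum_(0 <= j < n | j != k) `|a j| * `|h (t k) (y j)|.
      apply: le_trans (ler_norm_sum _ _ _) _.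
      by apply: ler_sum => j _; rewrite linearZ/= normrM.
    by apply: le_trans (lerB_normD _ _); rewrite lerB.
  apply: (@le_trans _ _ (\sum_(0 <= k < n) (`|a k| * d -
      \sum_(0 <= j < n | j != k) `|a j| * `|h (t k) (y j)|))); last first.
    by rewrite !big_nat; apply: ler_sum => k /andP[_ kn]; exact: hS.
  rewrite sumrB -mulr_suml.
  have : \sum_(0 <= k < n) \sum_(0 <= j < n | j != k) `|a j| * `|h (t k) (y j)| <=
      (\sum_(0 <= j < n) `|a j|) * (d / 2).
    rewrite (exchange_big_dep xpredT)//= mulr_suml; apply: ler_sum => j _.
    rewrite -mulr_sumr ler_wpM2l// -big_filter; apply: tP.
      by rewrite filter_uniq// iota_uniq.
    by rewrite mem_filter eqxx.
  by lra.
rewrite mulrC -ler_pdivlMr ?divr_gt0// l1_normE; apply: limr_le.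
  by have := l1_valP a; rewrite inE.
apply: nearW => n0; rewrite ler_pdivlMr ?divr_gt0//.
apply: (@cvg_ge_norm _ _ _ _ _ n0 (Tlim a)) => n n0n.
rewrite mulrA ler_pdivrMr// [leRHS]mulrC; apply: le_trans (lower n).
rewrite (ler_wpM2r (ltW d20))// /series /=.
by rewrite [leRHS](@big_cat_nat _ _ _ n0)//= lerDl sumr_ge0.
Qed.

End copy_of_l1.

(** * Unconditional convergence *)

(** A permutation of [nat] built block by block: with the indices below [m]
    already listed, the finite set [A m] comes next, followed by the remaining
    indices up to the maximum of [A m].  Each set [A m] that is used appears as a
    segment of consecutive terms of the rearrangement. *)
Lemma block_rearrangement (A : nat -> seq nat) :
    (forall n, uniq (A n)) -> (forall n, A n != [::]) ->
    (forall n, all (leq n) (A n)) ->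
  exists2 s : nat -> nat, bijective s & forall N, exists m,
    (N <= m)%N /\ [seq s i | i <- iota m (size (A m))] = A m.
Proof.
move=> Auniq An0 Age.
pose top n := (\max_(i <- A n) i).+1.
have Atop n i : i \in A n -> (n <= i < top n)%N.
  by move=> iA; rewrite (allP (Age n))//= ltnS (@leq_bigmax_seq _ (A n) xpredT id).
have ntop n : (n < top n)%N.
  have : head 0%N (A n) \in A n by rewrite -nth0 mem_nth// lt0n size_eq0.
  by move=> /Atop/andP[]; exact: leq_ltn_trans.
pose rest n := [seq i <- iota n (top n - n) | i \notin A n].
pose step L := L ++ A (size L) ++ rest (size L).
have block n : perm_eq (A n ++ rest n) (iota n (top n - n)).
  have AI : perm_eq (A n) [seq i <- iota n (top n - n) | i \in A n].
    apply: uniq_perm => // [|i]; first by rewrite filter_uniq// iota_uniq.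
    rewrite mem_filter mem_iota subnKC ?(ltnW (ntop n))//.
    by case: (boolP (i \in A n)) => //= /Atop.
  rewrite perm_sym -(perm_filterC (mem (A n))) perm_sym.
  by rewrite perm_cat2r; exact: AI.
pose L k := iter k step [::].
have LP k : perm_eq (L k) (iota 0 (size (L k))).
  elim: k => // k IH; rewrite [L k.+1]/= /step.
  set n := size (L k); have bn := perm_size (block n).
  rewrite [X in iota _ X]size_cat bn size_iota iotaD add0n.
  by apply: perm_cat => //; exact: block.
have Lsize k : (k <= size (L k))%N.
  elim: k => // k IH; rewrite [L k.+1]/= size_cat.
  rewrite (perm_size (block _)) size_iota.
  by have := ntop (size (L k)); lia.
have Lext k m i : (k <= m)%N -> (i < size (L k))%N -> nth 0%N (L m) i = nth 0%N (L k) i.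
  move=> /subnK <-; elim: (m - k)%N => // d IH ik.
  rewrite addSn [L _.+1]/= nth_cat -(IH ik) ifT//.
  apply: (leq_trans ik); elim: d {IH} => // d IH; apply: leq_trans IH _.
  by rewrite addSn [L _.+1]/= size_cat leq_addr.
(* [L i.+1] has more than [i] entries, so the default of [nth] is never met. *)
pose s i := nth 0%N (L i.+1) i.
have sE m i : (i < size (L m))%N -> s i = nth 0%N (L m) i.
  move=> im; have [mi|/ltnW im'] := leqP m i.+1; first exact: Lext.
  by apply/esym/Lext.
have Luniq k : uniq (L k) by rewrite (perm_uniq (LP k)) iota_uniq.
have s_inj : injective s.
  move=> i j; have [im jm] : (i < size (L (maxn i j).+1))%N /\ (j < size (L (maxn i j).+1))%N.
    by split; apply: leq_trans (Lsize _); rewrite ltnS ?leq_maxl ?leq_maxr.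
  by rewrite !(sE (maxn i j).+1)// => /eqP; rewrite nth_uniq// => /eqP.
have s_surj n : exists i, s i = n.
  have nL : n \in L n.+1 by rewrite (perm_mem (LP _)) mem_iota; exact: Lsize.
  by exists (index n (L n.+1)); rewrite (sE n.+1) ?nth_index// index_mem.
exists s.
  have [g gP] := choice s_surj; exists g => // i; apply: s_inj; exact: gP.
move=> N; exists (size (L N)); split; first exact: Lsize.
apply: (@eq_from_nth _ 0%N); rewrite size_map size_iota// => i iA.
rewrite (nth_map 0%N) ?size_iota// nth_iota// (sE N.+1).
  by rewrite [L N.+1]/= nth_cat ltnNge leq_addr/= addKn nth_cat iA.
by rewrite [L N.+1]/= !size_cat ltn_add2l (leq_trans iA)// leq_addr.
Qed.

Section unconditional.
Context {R : realType} {V : normedModType R}.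

(** Otherwise there are finite index sets arbitrarily far away with large sums, and
    the rearrangement that makes them consecutive is not Cauchy. *)
Lemma unconditionally_cvg_small_sums (y : nat -> V) (e : R) :
    unconditionally_cvg y -> 0 < e ->
  exists N, forall s, uniq s -> all (leq N) s -> `|\sum_(i <- s) y i| <= e.
Proof.
move=> ycvg e0; apply: contrapT => nsmall.
have /choice[A AP] N : exists s, [/\ uniq s, all (leq N) s & e < `|\sum_(i <- s) y i|].
  apply: contrapT => nA; apply: nsmall; exists N => s us sN.
  by rewrite leNgt; apply/negP => lt; apply: nA; exists s.
have [|||s sbij sA] := @block_rearrangement A.
- by move=> n; have [] := AP n.
- move=> n; apply/eqP => An; have [_ _] := AP n.
  by rewrite An big_nil normr0 ltNge ltW.
- by move=> n; have [] := AP n.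
have /cvg_cauchy/series_cauchyP/(_ e e0)[N NP] := ycvg s sbij.
have [m [Nm mA]] := sA N; have [_ _] := AP m.
rewrite ltNge => /negP; apply.
have -> : \sum_(i <- A m) y i = \sum_(m <= i < m + size (A m)) y (s i).
  by rewrite -[in LHS]mA big_map /index_iota addKn.
exact: NP m (m + size (A m))%N Nm (leq_addr _ _).
Qed.

Lemma unconditionally_cvg_bounded_sums (y : nat -> V) :
  unconditionally_cvg y ->
  exists M : R, forall s, uniq s -> `|\sum_(i <- s) y i| <= M.
Proof.
move=> /unconditionally_cvg_small_sums/(_ ltr01)[N NP].
exists (\sum_(0 <= i < N) `|y i| + 1) => s us.
rewrite (bigID (fun i => (i < N)%N))/=; apply: (le_trans (ler_normD _ _)).
rewrite lerD//; last first.
  rewrite -big_filter NP ?filter_uniq//; apply/allP => i.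
  by rewrite mem_filter -leqNgt => /andP[].
apply: le_trans (ler_norm_sum _ _ _) _; rewrite -[leLHS]big_filter.
have sE : perm_eq [seq i <- s | (i < N)%N] [seq i <- index_iota 0 N | i \in s].
  apply: uniq_perm => [||i]; rewrite ?filter_uniq ?iota_uniq//.
  by rewrite !mem_filter mem_index_iota andbC.
by rewrite (perm_big _ sE) big_filter [leRHS](bigID (mem s))/= lerDl sumr_ge0.
Qed.

End unconditional.

(** * Unconditional frames *)

Section blocks.
Context {R : realType} {V : normedModType R}.

Lemma not_cauchy_blocks (y : nat -> V) : ~ cauchy (series y @ \oo) ->
  exists (d : R) (p q : nat -> nat), [/\ 0 < d,
    forall k, (p k <= q k <= p k.+1)%N &
    forall k, d < `|\sum_(p k <= i < q k) y i|].
Proof.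
rewrite series_cauchyP => /existsNP[d /not_implyP[d0 dP]].
have /choice[pq pqP] N : exists mn : nat * nat,
    (N <= mn.1 <= mn.2)%N /\ d < `|\sum_(mn.1 <= i < mn.2) y i|.
  apply: contrapT => nN; apply: dP; exists N => m n Nm mn.
  rewrite leNgt; apply/negP => lt; apply: nN; exists (m, n).
  by rewrite /= Nm mn.
pose b k := iter k (fun N => (pq N).2) 0%N.
exists d, (fun k => (pq (b k)).1), (fun k => (pq (b k)).2); split=> // k.
  have [/andP[_ ->] _] := pqP (b k).
  by have [/andP[+ _] _] := pqP (b k.+1).
by have [] := pqP (b k).
Qed.

Lemma sum_blocks_le (u : nat -> R) (p q : nat -> nat) (B : R) :
    (forall i, 0 <= u i) -> (forall k, (p k <= q k <= p k.+1)%N) ->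
    (forall n, \sum_(0 <= i < n) u i <= B) ->
  forall n, \sum_(0 <= k < n) \sum_(p k <= i < q k) u i <= B.
Proof.
move=> u0 pq uB n; apply: le_trans (uB (p n)).
elim: n => [|n IH]; first by rewrite big_geq// sumr_ge0.
have /andP[pqn qpn] := pq n.
rewrite big_nat_recr//= [leRHS](@big_cat_nat _ _ _ (p n))//=; last first.
  exact: leq_trans qpn.
rewrite lerD// [leRHS](@big_cat_nat _ _ _ (q n))//=.
by rewrite lerDl sumr_ge0.
Qed.

End blocks.

Section frame.
Context {R : realType} {X : completeNormedModType R}.
Context (x : nat -> X) (f : nat -> dual X)
  (frame_xf : unconditional_frame x f).

Let T s z := \sum_(i <- s) f i z *: x i.

Let T_linear s : linear (T s).
Proof.
move=> a u v; rewrite /T scaler_sumr -big_split/=; apply: eq_bigr => i _.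
by rewrite linearP /= scalerDl scalerA.
Qed.

Let T_bound : exists2 M : R, 0 <= M & forall s z, uniq s -> `|T s z| <= M * `|z|.
Proof.
pose F := [set g : X -> X | exists2 s, uniq s & g = T s].
have [|z|M MP] := @Banach_Steinhauss R X X F _ _ 1.
- move=> _ [s us ->]; split=> // r.
  exists (\sum_(i <- s) (`|f i| * r) * `|x i|) => z zr.
  apply: le_trans (ler_norm_sum _ _ _) _; apply: ler_sum => i _.
  rewrite normrZ ler_wpM2r//; apply: le_trans (dual_eval_le _ _) _.
  by rewrite ler_wpM2l.
- have [M MP] := unconditionally_cvg_bounded_sums _ (frame_xf.2 z).
  by exists M => _ [s us ->]; exact: MP.
exists `|M| => // s z us.
pose Ts : {linear X -> X} := HB.pack (T s) (GRing.isLinear.Build _ _ _ _ _ (T_linear s)).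
have TZ (a : R) v : T s (a *: v) = a *: T s v := linearZ_LR Ts a v.
apply: (@le_trans _ _ (M * `|z|)); last by rewrite ler_wpM2r// ler_norm.
have T0 : T s 0 = 0 := linear0 Ts.
have [->|z0] := eqVneq z 0; first by rewrite T0 !normr0 mulr0.
have nz : 0 < `|z| by rewrite normr_gt0.
have := MP (T s) (ex_intro2 _ _ s us erefl) (`|z|^-1 *: z).
rewrite TZ !normrZ normfV normr_id mulVf ?gt_eqF// => /(_ (lexx _)).
by rewrite ler_pdivrMl// mulrC.
Qed.

(** [g (x_i) f_i (z)] is the value of [g] at [f_i (z) x_i]; summing separately over
    its positive and its negative terms reduces the absolute sum to two finite
    sums of the frame expansion. *)
Lemma frame_abs_sum_le : exists2 K : R, 0 <= K & forall (g : dual X) z n,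
  \sum_(0 <= i < n) `|g (x i) * f i z| <= K * `|g| * `|z|.
Proof.
have [M M0 MP] := T_bound; exists (M + M) => [|g z n]; first exact: addr_ge0.
have gT s : uniq s -> `|\sum_(i <- s) g (x i) * f i z| <= M * `|g| * `|z|.
  move=> us; have -> : \sum_(i <- s) g (x i) * f i z = g (T s z).
    by rewrite /T linear_sum; apply: eq_bigr => i _; rewrite linearZ mulrC.
  apply: le_trans (dual_eval_le _ _) _.
  by rewrite [leRHS]mulrAC [leRHS]mulrC ler_wpM2l// MP.
rewrite (bigID (fun i => 0 <= g (x i) * f i z))/= !mulrDl lerD//.
  rewrite (eq_bigr (fun i => g (x i) * f i z)) => [|i /ger0_norm//].
  rewrite -big_filter; apply: le_trans (ler_norm _) (gT _ _).
  by rewrite filter_uniq// iota_uniq.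
rewrite (eq_bigr (fun i => - (g (x i) * f i z))) => [|i]; last first.
  by rewrite -ltNge => /ltr0_norm.
rewrite sumrN -big_filter; apply: le_trans (ler_norm _) _.
by rewrite normrN gT// filter_uniq// iota_uniq.
Qed.

(** For suitable signs [e_i] the sum is [phi (sum_i e_i g (x_i) f_i)], and
    [frame_abs_sum_le] bounds the norm of the argument of [phi]. *)
Lemma frame_bidual_abs_sum_le : exists K : R, forall (phi : dual (dual X)) (g : dual X) n,
  \sum_(0 <= i < n) `|phi (f i) * g (x i)| <= K * `|phi| * `|g|.
Proof.
have [K K0 KP] := frame_abs_sum_le; exists K => phi g n.
pose e i : R := Num.sg (phi (f i) * g (x i)).
pose G : dual X := \sum_(0 <= i < n) (e i * g (x i)) *: f i.
have -> : \sum_(0 <= i < n) `|phi (f i) * g (x i)| = phi G.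
  rewrite /G linear_sum; apply: eq_bigr => i _.
  have phiE : phi ((e i * g (x i)) *: f i) = e i * (phi (f i) * g (x i)) :> R.
    by rewrite linearZ [phi (f i) * _]mulrC mulrA.
  by rewrite [RHS]phiE; exact: normrEsg.
have GK : `|G| <= K * `|g|.
  apply: dual_norm_le => [|z]; first exact: mulr_ge0.
  rewrite dual_sumE; apply: le_trans (KP g z n).
  apply: le_trans (ler_norm_sum _ _ _) _; apply: ler_sum => i _.
  have -> : ((e i * g (x i)) *: f i) z = e i * (g (x i) * f i z) :> R.
    by rewrite mulrA.
  rewrite normrM ler_piMl//.
  by rewrite normr_sg; case: (_ == _).
apply: le_trans (ler_norm _) _; apply: le_trans (dual_eval_le _ _) _.
by rewrite [leRHS]mulrAC [leRHS]mulrC ler_wpM2l.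
Qed.

(** Pointwise, [sum_i g (x_i) f_i] converges to [g] by the frame expansion; so it is
    enough that it is norm-Cauchy, and otherwise its blocks produce [l_1]. *)
Lemma no_l1_shrinking : ~ contains_copy X (l1 R) ->
  forall g : dual X, series (fun i => g (x i) *: f i) @ \oo --> g.
Proof.
move=> nl1 g; have [K K0 KP] := frame_abs_sum_le.
have /series_cauchyP gC : cauchy (series (fun i => g (x i) *: f i) @ \oo).
  apply: contrapT => /not_cauchy_blocks[d [p [q [d0 pq dP]]]]; apply: nl1.
  have /choice[z zP] k : exists z, `|z| <= 1 /\
      d <= `|(\sum_(p k <= i < q k) g (x i) *: f i) z|.
    by have [z z1 dz] := dual_norm_witness _ _ d0 (dP k); exists z.
  apply: (@contains_l1 _ _ z (fun k => \sum_(p k <= i < q k) g (x i) *: f i)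
    (K * `|g|) d d0) => [v n|k|k].
  - apply: le_trans (sum_blocks_le (fun i => `|g (x i) * f i v|) p q _ _ pq
      (KP g v) n) => //.
    by apply: ler_sum => k _; rewrite dual_sumE; exact: ler_norm_sum.
  - exact: (zP k).1.
  - exact: (zP k).2.
apply/cvgrPdist_le => e e0; have [N NP] := gC e e0.
exists N => // n Nn; apply: dual_norm_le; first exact: ltW.
move=> z; set S := series _.
have Sz : (S m - S n) z @[m --> \oo] --> (g z - S n z : R^o).
  have : g (series (fun i => f i z *: x i) m) @[m --> \oo] --> (g z : R^o).
    by apply: (@continuous_cvg _ _ _ _ _ _ g); [exact: dual_continuous|exact: frame_xf.1.2].
  move=> gz; apply: cvgB; last exact: cvg_cst.
  apply: cvg_trans gz; apply: near_eq_cvg; apply: nearW => m /=.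
  rewrite /S /series /= dual_sumE linear_sum; apply: eq_bigr => i _.
  by rewrite linearZ; exact: mulrC.
apply: (cvg_le_norm _ _ _ n Sz) => m nm; apply: le_trans (dual_eval_le _ _) _.
by rewrite ler_wpM2r// /S sub_series_geq// NP.
Qed.

Lemma no_c0_boundedly_complete : ~ contains_copy X (c0 R) ->
  forall phi : dual (dual X), cvgn (series (fun i => phi (f i) *: x i)).
Proof.
move=> nc0 phi; have [K KP] := frame_bidual_abs_sum_le.
apply: cauchy_cvg; apply: contrapT => /not_cauchy_blocks[d [p [q [d0 pq dP]]]].
apply: nc0.
apply: (@contains_c0 _ _ (fun k => \sum_(p k <= i < q k) phi (f i) *: x i)
  (K * `|phi|) d d0) => [g n|k]; last exact: ltW.
apply: le_trans (sum_blocks_le (fun i => `|phi (f i) * g (x i)|) p q _ _ pq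
  (KP phi g) n) => //.
apply: ler_sum => k _; rewrite linear_sum; apply: le_trans (ler_norm_sum _ _ _) _.
by apply: ler_sum => i _; rewrite linearZ.
Qed.

Lemma no_c0_l1_reflexive : ~ contains_copy X (c0 R) ->
  ~ contains_copy X (l1 R) -> reflexive_space X.
Proof.
move=> nc0 nl1 phi; pose u := fun i => phi (f i) *: x i.
exists (limn (series u)); apply/val_inj/funext => g /=.
have gu : g (series u n) @[n --> \oo] --> (g (limn (series u)) : R^o).
  apply: (@continuous_cvg _ _ _ _ _ _ g); first exact: dual_continuous.
  exact: no_c0_boundedly_complete.
have : phi (series (fun i => g (x i) *: f i) n) @[n --> \oo] --> (phi g : R^o).
  apply: (@continuous_cvg _ _ _ _ _ _ phi); first exact: dual_continuous.
  exact: no_l1_shrinking.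
suff -> : (fun n => phi (series (fun i => g (x i) *: f i) n)) =
          (fun n => g (series u n)) by move=> /(norm_cvg_unique gu).
apply/funext => n; rewrite /series /= !linear_sum; apply: eq_bigr => i _.
by rewrite !linearZ; exact: mulrC.
Qed.

End frame.

(** * Sequences in reflexive spaces *)

Section reflexive_limits.
Context {R : realType} {X : normedModType R}.

(** The point represents a linear functional on [X*] dominated by the sublinear
    functional [g |-> limsup g (w_n)], that is, a Banach limit. *)
Lemma reflexive_weak_cluster (w : nat -> X) (M : R) : reflexive_space X ->
    (forall n, `|w n| <= M) ->
  exists z, forall (g : dual X) (c : R), g (w n) @[n --> \oo] --> (c : R^o) -> g z = c.
Proof.
move=> refl wM; have M0 : 0 <= M by apply: le_trans (wM 0%N).
have gwM (g : dual X) k : `|g (w k)| <= M * `|g|.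
  by apply: le_trans (dual_eval_le _ _) _; rewrite mulrC ler_wpM2r.
pose tail (g : dual X) n := [set g (w k) | k in [set k | (n <= k)%N]].
pose h n (g : dual X) : R := sup (tail g n).
have h_ge (g : dual X) n k : (n <= k)%N -> g (w k) <= h n g.
  move=> nk; apply: ub_le_sup; last by exists k.
  by exists (M * `|g|) => _ [j _ <-]; exact: le_trans (ler_norm _) (gwM g j).
have h_le (g : dual X) n (B : R) : (forall k, (n <= k)%N -> g (w k) <= B) -> h n g <= B.
  move=> gB; apply: ge_sup; first by exists (g (w n)), n => /=.
  by move=> _ [k /= nk <-]; exact: gB.
have [|||sp ph] := @inf_sublinear R (dual X) _ 0%N h.
- move=> g; exists (- (M * `|g|)) => n; apply: le_trans (h_ge g n n _) => //.
  by have := gwM g n; rewrite ler_norml => /andP[].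
- move=> i j g g'; exists (maxn i j); apply: h_le => k.
  by rewrite geq_max => /andP[ik jk]; apply: lerD; exact: h_ge.
- move=> i t g t0; exists i; apply: h_le => k ik.
  by rewrite [leLHS]/(t * g (w k)) (ler_wpM2l (ltW t0)) ?h_ge.
have [F [lF Fp _]] := hahn_banach_sublinear _ 0 sp.
have [|Phi PhiF _] := dual_of_bounded F M M0 lF.
  move=> g; apply: le_trans (Fp g) _; apply: le_trans (ph 0%N g) _.
  by apply: h_le => k _; exact: le_trans (ler_norm _) (gwM g k).
have Phi_le (g : dual X) (c : R) : g (w n) @[n --> \oo] --> (c : R^o) -> Phi g <= c.
  move=> gc; apply/ler_addgt0Pr => e e0.
  move/cvgrPdist_le : gc => /(_ e e0)[N _ NP].
  rewrite PhiF; apply: le_trans (Fp g) _; apply: le_trans (ph N g) _.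
  by apply: h_le => k Nk; have := NP k Nk; rewrite ler_distlC => /andP[_].
have [z zPhi] := refl Phi; exists z => g c gc.
have -> : g z = Phi g by rewrite -zPhi.
apply/eqP; rewrite eq_le Phi_le//=.
have : Phi (- g) <= - c by apply: Phi_le; exact: cvgN.
by rewrite linearN lerN2.
Qed.

(** A weak cluster point [z] of [T v_n] lies in the closure of the range of [T]:
    functionals vanishing on the range vanish at [z].  A preimage [u] of a point
    of the range near [z] does the job, because [l] is transported to [X] with
    norm at most [1 / a]. *)
Lemma reflexive_copy_weak_cluster {E : normedModType R} (v : nat -> E) (M e : R) :
    reflexive_space X -> contains_copy X E -> (forall n, `|v n| <= M) -> 0 < e ->
  exists u : E, forall (l : E -> R^o) (c : R), linear l -> (forall u', `|l u'| <= `|u'|) ->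
    l (v n) @[n --> \oo] --> (c : R^o) -> `|c - l u| <= e.
Proof.
move=> refl [T [a [b [a0 b0 Tab]]]] vM e0.
have [|z zP] := reflexive_weak_cluster (T \o v) (b * M) refl.
  move=> n; have /andP[_ /le_trans] := Tab (v n); apply.
  by rewrite ler_wpM2l// ltW.
have [u uz] : exists u, `|z - T u| < e * a.
  apply: contrapT => nu.
  have l0 : linear (\0 : E -> R^o) by move=> k p q /=; rewrite scaler0 addr0.
  have [|g [_ gT gz]] := hahn_banach_through T _ 1 z l0 ler01.
    by move=> p; rewrite /= normr0 mul1r.
  have : e * a <= g z.
    apply: gz => u; rewrite /= add0r mul1r leNgt; apply/negP => lt.
    by apply: nu; exists u.
  rewrite (zP g 0) ?leNgt ?mulr_gt0//.
  by apply: cvg_near_cst; apply: nearW => n; exact: gT.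
exists u => l c ll lu lc.
have [||g [ga gT _]] := hahn_banach_through T l a^-1 z ll.
- by rewrite invr_ge0 ltW.
- move=> p; apply: le_trans (lu p) _; rewrite ler_pdivlMl//.
  by have /andP[] := Tab p.
have gz : g z = c.
  by apply: zP; apply: cvg_trans lc; apply: near_eq_cvg; apply: nearW => n; rewrite /= gT.
rewrite -gz -gT -linearB; apply: le_trans (dual_eval_le _ _) _.
apply: (@le_trans _ _ (a^-1 * (e * a))); first by rewrite ler_pM// ltW.
by rewrite mulrC mulfK// gt_eqF.
Qed.

(** Every coordinate of [e_0 + ... + e_(n-1)] tends to 1, and no element of [c_0]
    has all its coordinates at distance at most 1/2 from 1. *)
Lemma reflexive_no_c0 : reflexive_space X -> ~ contains_copy X (c0 R).
Proof.
move=> refl copy.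
have vP n : (fun k => (k < n)%:R : R^o) \in @vanishing R.
  rewrite inE /=; apply: cvg_near_cst; exists n => // k /= nk.
  by rewrite ltnNge nk.
have [||u uP] := reflexive_copy_weak_cluster (fun n => C0 (vP n)) 1 2^-1 refl copy.
- move=> n; rewrite c0_normE; apply: ge_sup; first by exists `|(0 < n)%:R|, 0%N.
  by move=> _ [k _ <-] /=; case: (_ < _)%N; rewrite ?normr1 ?normr0.
- by rewrite invr_gt0.
have uk k : `|1 - u k| <= 2^-1.
  apply: (uP (fun a => a k)) => //; first by move=> a; exact: c0_le_norm.
  by apply: cvg_near_cst; exists k.+1 => // n /= ->.
have half0 : 0 < 2^-1 :> R by rewrite invr_gt0.
have := c0_valP u; rewrite inE /= => /cvgrPdist_lt/(_ _ half0)[N _ /(_ N (leqnn _))].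
rewrite sub0r normrN => uN; have := uk N.
have := ler_normD (1 - u N) (u N); rewrite subrK normr1; lra.
Qed.

(** The functional [l a = sum_(j >= N) a_j] has norm at most 1 and tends to 1 along
    the unit vectors, but it is at most 1/4 at a given [u] once [N] is large. *)
Lemma reflexive_no_l1 : reflexive_space X -> ~ contains_copy X (l1 R).
Proof.
move=> refl copy.
have seriesE n m : (n < m)%N -> series (fun k => `|(k == n)%:R| : R^o) m = 1.
  move=> nm; rewrite /series /= (bigD1_seq n)/= ?mem_index_iota ?iota_uniq//.
  by rewrite eqxx normr1 big1 ?addr0// => k /negbTE ->; rewrite normr0.
have scvg n : series (fun k => `|(k == n)%:R| : R^o) @ \oo --> (1 : R^o).
  by apply: cvg_near_cst; exists n.+1 => // m /= nm; exact: seriesE.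
have vP n : (fun k => (k == n)%:R : R^o) \in @abs_summable R.
  by rewrite inE; apply/cvgP; exact: scvg.
have [||u uP] := reflexive_copy_weak_cluster (fun n => L1 (vP n)) 1 2^-1 refl copy.
- by move=> n; rewrite l1_normE (cvg_lim _ (scvg n)).
- by rewrite invr_gt0.
have l1C (a : l1 R) : cauchy (series (fun k => `|a k| : R^o) @ \oo).
  by apply: cvg_cauchy; have := l1_valP a; rewrite inE.
have quarter0 : 0 < 4^-1 :> R by rewrite invr_gt0.
have /series_cauchyP/(_ _ quarter0)[N NP] := l1C u.
pose y j : R^o := (N <= j)%:R.
have y1 j : `|y j| <= 1 by rewrite /y; case: (N <= j)%N; rewrite ?normr1 ?normr0.
have ay (a : l1 R) m n : `|\sum_(m <= j < n) a j *: y j| <= \sum_(m <= j < n) `|a j|.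
  apply: le_trans (ler_norm_sum _ _ _) _; apply: ler_sum => j _.
  by rewrite normrZ -[leRHS]mulr1 ler_wpM2l.
have [|a|l lP] := @synthesis_linear R R^o (l1 R) (@l1_val R) y.
- by [].
- apply/series_cauchyP => e e0; have /series_cauchyP/(_ e e0)[N' N'P] := l1C a.
  exists N' => m n Nm mn; apply: le_trans (ay _ _ _) _.
  by apply: le_trans (N'P m n Nm mn); exact: ler_norm.
have lu : `|l u| <= 4^-1.
  apply: (cvg_le_norm _ _ _ N (lP u)) => n Nn.
  rewrite /series /= (@big_cat_nat _ _ _ N)//= big1_seq ?add0r => [|j].
    apply: le_trans (ay _ _ _) _; apply: le_trans (NP N n (leqnn _) Nn).
    exact: ler_norm.
  by rewrite mem_index_iota /y => /andP[_ /andP[_ jN]]; rewrite leqNgt jN scaler0.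
have le n : (N <= n)%N -> l (L1 (vP n)) = 1.
  move=> Nn; apply: (norm_cvg_unique (lP (L1 (vP n)))).
  apply: cvg_near_cst; exists n.+1 => // m /= nm.
  rewrite /series /= (bigD1_seq n)/= ?mem_index_iota ?iota_uniq//.
  rewrite /y Nn eqxx scale1r big1 ?addr0// => k /negbTE ->.
  by rewrite scale0r.
have : `|1 - l u| <= 2^-1.
  apply: uP => [|a|].
  - exact: linearP.
  - apply: (cvg_le_norm _ _ _ 0%N (lP a)) => n _.
    exact: le_trans (ay _ _ _) (l1_partial_le_norm _ _).
  - by apply: cvg_near_cst; exists N.
have := ler_normD (1 - l u) (l u); rewrite subrK normr1; move: lu; lra.
Qed.

End reflexive_limits.

(** * The characterization of reflexivity *)

Theorem theoremC (R : realType) (X : completeNormedModType R)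
    (x : nat -> X) (f : nat -> dual X)
    (sepX : separable_space X)
    (frame_xf : unconditional_frame x f)
    (tail0 : forall m : nat,
      restr_norm (lin_span [set x i | i in [set i | (n <= i)%N]]) (f m)
        @[n --> \oo] --> (0 : R)) :
  reflexive_space X <->
    ~ contains_copy X (c0 R) /\ ~ contains_copy X (l1 R).
Proof.
split=> [refl|[nc0 nl1]].
  by split; [exact: reflexive_no_c0|exact: reflexive_no_l1].
exact: no_c0_l1_reflexive frame_xf nc0 nl1.
Qed.
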